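(* Let $d\ge 4$ and $n\ge d+3$ be integers, let $U$ be a set of size $n-6$, and let $C=\{a,b,\alpha,\beta,\gamma,x\}$ be a set of six distinct points disjoint from $U$. Suppose that $$\mathcal{H}\subseteq\binom{\{x\}\cup U}{d-2},\quad \operatorname{VC}(\mathcal{H})\le d-3,\qquad\text{and}\qquad \mathcal{K}_1,\mathcal{K}_2\subseteq\binom{U}{d-3},\quad \operatorname{VC}(\mathcal{K}_i)\le d-4\ \ (i=1,2).$$ Then there is a family $\mathcal{F}\subseteq\binom{C\cup U}{d+1}$ with $\operatorname{VC}(\mathcal{F})\le d$ and $$|\mathcal{F}|=\binom{n-1}{d}+\binom{n-4}{d-2}+|\mathcal{H}|+|\mathcal{K}_1|+|\mathcal{K}_2|.$$
   Context: For a finite set $X$, a family $\mathcal{F}\subseteq 2^X$ and a set $S\subseteq X$, the trace of $\mathcal{F}$ on $S$ is $\operatorname{Tr}_{\mathcal{F}}(S)=\{F\cap S: F\in\mathcal{F}\}$. The set $S$ is shattered by $\mathcal{F}$ if $\operatorname{Tr}_{\mathcal{F}}(S)=2^S$, and the VC-dimension $\operatorname{VC}(\mathcal{F})$ is the maximum size of a set shattered by $\mathcal{F}$ (the empty family shatters no set, and its VC-dimension is taken to be $-\infty$). $\binom{X}{r}$ denotes the set of all $r$-element subsets of $X$, with $\binom{X}{r}=\emptyset$ if $r<0$ or $r>|X|$; the numerical binomial coefficient $\binom{m}{r}$ is $0$ if $r<0$ or $r>m$. *)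

(* Defs.v *)
From mathcomp Require Import all_boot all_order all_algebra.
From mathcomp Require Import constructive_ereal.
Set Implicit Arguments.
Unset Strict Implicit.
Unset Printing Implicit Defensive.
Import Order.TTheory GRing.Theory Num.Theory.

Definition layer (T : finType) (X : {set T}) (r : nat) : {set {set T}} :=
  [set A : {set T} | (A \subset X) && (#|A| == r)].

Definition trace (T : finType) (F : {set {set T}}) (S : {set T}) :
    {set {set T}} :=
  [set A :&: S | A in F].

Definition shattered (T : finType) (F : {set {set T}}) (S : {set T}) : bool :=
  trace F S == powerset S.

(* S ranges over all subsets of T rather than of a ground set X: if every
   member of F is contained in X, a set shattered by F is contained in X, since
   it belongs to its own trace.  The value is -oo exactly when F is empty: any
   other family shatters set0. *)
Definition VC (T : finType) (F : {set {set T}}) : \bar int :=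
  \big[maxe/-oo%E]_(S : {set T} | shattered F S) (#|S|%:Z)%:E.

(* Main.v *)
Require Import Defs.
From mathcomp Require Import all_boot all_order all_algebra.
From mathcomp Require Import constructive_ereal.
From mathcomp Require Import zify.
Set Implicit Arguments.
Unset Strict Implicit.
Unset Printing Implicit Defensive.
Import Order.TTheory GRing.Theory Num.Theory.

(** Sort the (d+1)-subsets A of C :|: U by their word, the characteristic
    vector of A :&: C (a trace on C). The family F takes all sets whose word is
    free, and, at four reserved words, only as many sets as H, K1 and K2
    provide: D :|: h with D = {a, beta, gamma} and h in H (h may contain x, so
    two words are involved), {b, alpha, beta, x} :|: k with k in K1, and
    {a, b, alpha, gamma} :|: k with k in K2. The free words are the point a, the
    five edges of the tree ab, ax, a alpha, b beta, b gamma, eleven triples, and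
    everything of size at least four that is not reserved.

    F is uniform, so a shattered set with d+1 points would be a member of F
    ([VC_uniform]); thus each member A must have a subset that is not the trace
    on A of any member of F. To find one, fix a subset Q of A outside a set V
    and look at the members that meet A :\: V exactly in Q: if their
    intersections with V lie in a family that does not shatter A :&: V, then
    some Q :|: h is not a trace ([link_not_shattered]). For every used word w
    there is such a Q of one of three kinds ([used_word_escapes]).
    - With V = U: every used word meeting w in Q is longer than w, so a member
      realising Q has fewer points in U than A has and cannot cover A :&: U.
      For instance Q is empty when w = {a, b}: every used word avoiding a and b
      has at least three points.
    - With V = U and w of size four: Q leads to K1 only, or to K2 only. This
      happens for Q = {alpha, x} in {a, alpha, gamma, x} (only
      {b, alpha, beta, x} remains) and for Q = {alpha, gamma} in
      {alpha, beta, gamma, x} (only {a, b, alpha, gamma} remains). Here A :&: U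
      has d-3 points, too many for K1 or K2 to shatter.
    - With V = x |: U and three points of w other than x: Q leads to H only.
      This happens for Q = {beta} in {b, alpha, beta}, with or without x, and
      for Q = {gamma} in {b, alpha, gamma, x}. Here A :&: V has d-2 points, too
      many for H to shatter.

    For the size, the reserved part contributes #|H| + #|K1| + #|K2|
    ([card_link]). The number of (d+1)-sets with a given word depends only on
    the size of the word ([card_code_eq]), and the free words have the same
    sizes, with multiplicity, as the words containing a together with those
    containing a, b, alpha and avoiding beta ([free_weights]); counting the
    sets with such words directly gives the two binomial coefficients. *)

(** * Shattering and links *)

Lemma shatteredP (T : finType) (F : {set {set T}}) (S : {set T}) :
  reflect (forall Q : {set T}, Q \subset S -> exists2 A, A \in F & A :&: S = Q)
          (shattered F S).
Proof.
apply: (iffP eqP) => [trE Q sQS | hits].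
  have: Q \in trace F S by rewrite trE inE.
  by case/imsetP=> A FA ->; exists A.
apply/setP=> Q; rewrite inE; apply/imsetP/idP => [[A _ ->]|/hits[A FA <-]].
  exact: subsetIr.
by exists A.
Qed.

Lemma VC_leP (T : finType) (F : {set {set T}}) (m : int) :
  reflect (forall S, shattered F S -> (#|S|%:Z <= m)%R) (VC F <= m%:E)%E.
Proof.
rewrite /VC; apply: (iffP (bigmax_leP _ _ _ _)) => [[_ VCm] S /VCm | VCm].
  by rewrite lee_fin.
by split=> [|S /VCm]; rewrite ?leNye ?lee_fin.
Qed.

Lemma not_shattered_small (T : finType) (F : {set {set T}}) (S : {set T}) :
  (forall A, A \in F -> #|A| < #|S|) -> ~~ shattered F S.
Proof.
move=> small; apply/shatteredP=> /(_ S (subxx S))[A /small ltAS AS].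
by move: ltAS; rewrite ltnNge subset_leq_card // -AS subsetIl.
Qed.

Lemma card_gt_VC (T : finType) (F : {set {set T}}) (S : {set T}) (d c : nat) :
  (VC F <= (d%:Z - c%:Z)%:E)%E -> c + #|S| = d.+1 -> ~~ shattered F S.
Proof. by move=> /VC_leP VCF cS; apply/negP=> /VCF; lia. Qed.

(** A shattered S is the trace on itself of some member, hence contained in it;
    only S equal to that member could be too large. *)
Lemma VC_uniform (T : finType) (F : {set {set T}}) (X : {set T}) (r : nat) :
  F \subset layer X r.+1 ->
  (forall A, A \in F -> ~~ shattered F A) -> (VC F <= r%:Z%:E)%E.
Proof.
move=> /subsetP FX nshF; apply/VC_leP => S shS.
have [A FA AS] := shatteredP _ _ shS S (subxx S).
have sSA : S \subset A by rewrite -AS subsetIl.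
have /[!inE] /andP[_ /eqP cA] := FX _ FA.
suff: #|S| < #|A| by lia.
rewrite proper_card // properE sSA; apply: contra (nshF A FA) => sAS.
by suff -> : A = S by []; apply/eqP; rewrite eqEsubset sAS.
Qed.

(** If F shattered A, then for each h inside A :&: V some member would have
    trace Q :|: h on A; its part in V belongs to G and has trace h on A :&: V, so
    G would shatter A :&: V. *)
Lemma link_not_shattered (T : finType) (F G : {set {set T}})
    (A V Q : {set T}) :
  Q \subset A :\: V ->
  (forall B, B \in F -> B :&: (A :\: V) = Q -> B :&: V \in G) ->
  ~~ shattered G (A :&: V) -> ~~ shattered F A.
Proof.
move=> sQ toG; apply: contra => /shatteredP shF; apply/shatteredP => h sh.
have [|B FB /setP BA] := shF (Q :|: h).
  rewrite subUset (subset_trans sQ (subsetDl _ _)).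
  by rewrite (subset_trans sh (subsetIl _ _)).
exists (B :&: V).
  apply: toG => //; apply/setP=> y; move: (BA y) (subsetP sQ y) (subsetP sh y).
  rewrite !inE; case: (y \in B); case: (y \in A); case: (y \in V);
    by case: (y \in Q); case: (y \in h) => //= _ H1 H2;
       first [have := H1 isT | have := H2 isT].
apply/setP=> y; move: (BA y) (subsetP sQ y) (subsetP sh y).
rewrite !inE; case: (y \in B); case: (y \in A); case: (y \in V);
  by case: (y \in Q); case: (y \in h) => //= _ H1 H2;
     first [have := H1 isT | have := H2 isT].
Qed.

(** * Recording the trace of a set on a list of points *)

Section Code.

Variables (T : finType) (p : seq T).
Implicit Types (A B V : {set T}) (v w : bitseq).

Definition code A : bitseq := [seq y \in A | y <- p].

Definition decode w : {set T} := [set y in mask w p].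

Definition meet v w : bitseq := [seq vw.1 && vw.2 | vw <- zip v w].

Definition weight w : nat := count id w.

Lemma size_code A : size (code A) = size p.
Proof. exact: size_map. Qed.

Lemma codeI A B : code (A :&: B) = meet (code A) (code B).
Proof. by rewrite /code /meet; elim: p => //= y s ->; rewrite inE. Qed.

Lemma code_inj A B :
  A \subset [set y in p] -> B \subset [set y in p] -> code A = code B -> A = B.
Proof.
move=> /subsetP Ap /subsetP Bp /eq_in_map eqAB; apply/setP=> y.
have [/eqAB //|py] := boolP (y \in p).
by apply/idP/idP=> [/Ap|/Bp] /[!inE] /(negP py).
Qed.

Lemma decode_sub w : decode w \subset [set y in p].
Proof. by apply/subsetP=> y /[!inE]; apply: mem_mask. Qed.

Lemma decodeK w : uniq p -> size w = size p -> code (decode w) = w.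
Proof.
move=> Up szw; apply: (@eq_from_nth _ false); rewrite size_code // => i lti.
have y0 : T by case: p lti.
by rewrite (nth_map y0) // inE in_mask // mem_nth // index_uniq.
Qed.

Lemma weight_code A : uniq p -> weight (code A) = #|A :&: [set y in p]|.
Proof.
move=> Up; rewrite /weight /code count_map -size_filter.
have /card_uniqP <- := filter_uniq (mem A) Up.
by apply: eq_card => y; rewrite !inE mem_filter.
Qed.

Lemma card_decode w : uniq p -> size w = size p -> #|decode w| = weight w.
Proof.
move=> Up szw; rewrite -{2}(decodeK Up szw) weight_code //.
by rewrite (setIidPl (decode_sub w)).
Qed.

Lemma meet_codeD A V w : A :\: V = decode w -> uniq p -> size w = size p ->
  meet (code A) (code (~: V)) = w.
Proof. by move=> AV Up szw; rewrite -codeI -setDE AV decodeK. Qed.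

Lemma decode_subset A w : A \subset [set y in p] -> uniq p ->
  size w = size p -> meet w (code A) = w -> decode w \subset A.
Proof.
move=> Ap Up szw wA; apply/setIidPl/code_inj.
- exact: subset_trans (subsetIr _ _) Ap.
- exact: decode_sub.
- by rewrite codeI decodeK.
Qed.

End Code.

Definition words (k : nat) : seq bitseq :=
  iter k (fun ws => [seq b :: w | b <- [:: false; true], w <- ws]) [:: [::]].

Lemma mem_words k w : (w \in words k) = (size w == k).
Proof.
elim: k w => [|k IH] w; first by rewrite /= inE size_eq0.
apply/allpairsP/idP => [[[b v] [_ /= + ->]]|]; first by rewrite IH.
case: w => [|b w] //; rewrite /= eqSS -IH => wk.
by exists (b, w); split=> //=; case: b.
Qed.

Lemma uniq_words k : uniq (words k).
Proof.
elim: k => //= k IH; rewrite -/(words k) cats0 cat_uniq !map_inj_uniq ?IH //;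
  try by move=> ? ? [].
by rewrite andbT /=; apply/hasPn => _ /mapP[w _ ->]; apply/negP=> /mapP[? _].
Qed.

(** * The pattern on the six points *)

Definition word (s : seq nat) : bitseq := [seq i \in s | i <- iota 0 6].

Local Notation i_a := 0 (only parsing).
Local Notation i_b := 1 (only parsing).
Local Notation i_alpha := 2 (only parsing).
Local Notation i_beta := 3 (only parsing).
Local Notation i_gamma := 4 (only parsing).
Local Notation i_x := 5 (only parsing).

Definition small_free : seq bitseq := [seq word s | s <-
  [:: [:: i_a];
      [:: i_a; i_b]; [:: i_a; i_x]; [:: i_a; i_alpha];
      [:: i_b; i_beta]; [:: i_b; i_gamma];
      [:: i_a; i_b; i_x]; [:: i_a; i_b; i_alpha]; [:: i_a; i_alpha; i_x];
      [:: i_a; i_b; i_beta]; [:: i_b; i_beta; i_x]; [:: i_a; i_alpha; i_beta];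
      [:: i_b; i_alpha; i_beta]; [:: i_a; i_b; i_gamma];
      [:: i_b; i_gamma; i_x]; [:: i_b; i_beta; i_gamma];
      [:: i_alpha; i_beta; i_gamma]]].

(** The words of the parts of the members outside the ground set of H, of K1 and
    of K2 respectively. *)
Definition wH : bitseq := word [:: i_a; i_beta; i_gamma].
Definition wK1 : bitseq := word [:: i_b; i_alpha; i_beta; i_x].
Definition wK2 : bitseq := word [:: i_a; i_b; i_alpha; i_gamma].

(** Intersecting with [offx] forgets x, the point of C that members of H may
    contain. *)
Definition offx : bitseq := word [:: i_a; i_b; i_alpha; i_beta; i_gamma].

Definition reserved : pred bitseq :=
  fun w => [|| meet w offx == wH, w == wK1 | w == wK2].

Definition free : pred bitseq :=
  fun w => (w \in small_free) || (4 <= weight w) && ~~ reserved w.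

Definition used_words : seq bitseq :=
  [seq w <- words 6 | free w || reserved w].

(** A word Q inside M such that any member meeting the points of M exactly in Q
    has a good word; this is the finite hypothesis that makes
    [link_not_shattered] applicable. *)
Definition escapes (M : bitseq) (good : pred bitseq) : bool :=
  has (fun Q => (meet Q M == Q) &&
         all good [seq R <- used_words | meet R M == Q]) (words 6).

(** A finite check over the 64 words; the three alternatives give a missing
    trace for size reasons, through K1 or K2, and through H respectively. *)
Lemma used_word_escapes w : w \in used_words ->
  [|| escapes w (fun R => weight w < weight R),
      (weight w == 4) && (escapes w (pred1 wK1) || escapes w (pred1 wK2))
    | (weight (meet w offx) == 3) &&
      escapes (meet w offx) (fun R => meet R offx == wH)].
Proof. by move: w; apply/allP; vm_compute. Qed.

Lemma free_not_reserved w : size w = 6 -> free w -> ~~ reserved w.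
Proof.
move=> /eqP; rewrite -mem_words => w6; apply/implyP; move: w w6; apply/allP.
by vm_compute.
Qed.

(** Both sides consist of 1, 5, 11, 12, 6 and 1 words of size 1 to 6. The right
    side selects families that can be counted without splitting them by word. *)
Lemma free_weights :
  perm_eq [seq weight w | w <- words 6 & free w]
    ([seq weight w | w <- words 6 & nth false w i_a] ++
     [seq weight w | w <- words 6 &
       [&& nth false w i_a, nth false w i_b, nth false w i_alpha
         & ~~ nth false w i_beta]]).
Proof. by vm_compute. Qed.

(** Membership in G has to be known for good words only, because [escapes] rules
    out all other words for the members selected by its witness. *)
Lemma escape_not_shattered (T : finType) (p : seq T) (M : bitseq)
    (good : pred bitseq) (F G : {set {set T}}) (A V : {set T}) :
  uniq p -> size p = 6 -> escapes M good ->
  (forall B, B \in F -> code p B \in used_words) ->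
  A :\: V \subset [set y in p] -> code p (A :\: V) = M ->
  (forall B, B \in F -> good (code p B) -> B :&: V \in G) ->
  ~~ shattered G (A :&: V) -> ~~ shattered F A.
Proof.
move=> Up p6 /hasP[Q]; rewrite mem_words => /eqP Q6 /andP[/eqP QM] /allP goodQ.
move=> used AVp AVM toG; apply: (@link_not_shattered _ _ _ _ _ (decode p Q)).
  by apply: (@decode_subset _ p); rewrite ?p6 // AVM.
move=> B FB BQ; apply: toG => //; apply: goodQ.
by rewrite mem_filter used // -AVM -codeI BQ decodeK ?p6 ?eqxx.
Qed.

(** * Counting *)

(** Such sets are I together with r - #|I| points outside both I and O. *)
Lemma card_in_out (T : finType) (X I O : {set T}) (r : nat) :
  I \subset X -> O \subset X -> [disjoint I & O] -> #|I| <= r ->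
  #|[set A in layer X r | (I \subset A) && [disjoint A & O]]|
    = 'C(#|X| - #|I| - #|O|, r - #|I|).
Proof.
move=> IX OX dIO Ir.
rewrite -[#|X| - _ - _](_ : #|X :\: I :\: O| = _); last first.
  by rewrite !cardsDS // subsetD OX disjoint_sym.
rewrite -cards_draws; set S := [set A in _ | _]; set D := [set B | _].
have SI A : A \in S -> I \subset A by rewrite !inE => /and3P[].
have -> : D = [set A :\: I | A in S].
  apply/setP=> B; apply/idP/imsetP=> [|[A]]; last first.
    rewrite !inE => /and3P[/andP[AX /eqP cA] IA dAO] ->.
    rewrite cardsDS // cA eqxx andbT subsetD (setSD _ AX) /=.
    exact: disjointWl (subsetDl _ _) dAO.
  rewrite !inE !subsetD -!andbA => /and4P[BX dBI dBO /eqP cB].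
  have IB : I :&: B = set0 by apply/eqP; rewrite setI_eq0 disjoint_sym.
  exists (I :|: B); last by rewrite setDUl setDv set0U (setDidPl _).
  rewrite !inE subUset IX BX cardsU IB cards0 cB subsetUl subn0 subnKC // eqxx.
  by rewrite -setI_eq0 setIUl setU_eq0 !setI_eq0 dIO.
rewrite card_in_imset // => A B /SI IA /SI IB eqAB.
by rewrite -(setID A I) -(setID B I) (setIidPr IA) (setIidPr IB) eqAB.
Qed.

(** A set with a known word is determined by its part in U, whose size is
    prescribed. The condition is written with a sum, so that it is
    correctly unsatisfiable when the word alone has more than r points. *)
Lemma card_code_eq (T : finType) (p : seq T) (U : {set T}) (r : nat) w :
  uniq p -> [disjoint [set y in p] & U] -> size w = size p ->
  #|[set A in layer ([set y in p] :|: U) r | code p A == w]|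
    = #|[set B : {set T} | (B \subset U) && (#|B| + weight w == r)]|.
Proof.
move=> Up dpU szw; set C := [set y in p]; set S := [set A in _ | _].
have SE A : A \in S -> A = (A :&: U) :|: decode p w.
  rewrite !inE => /andP[/andP[AX _] /eqP wA].
  have <- : A :&: C = decode p w; last by rewrite setUC -setIUr (setIidPl AX).
  apply: (@code_inj _ p); rewrite ?subsetIr ?decode_sub // decodeK // -wA.
  by apply/eq_in_map=> y py; rewrite !inE py andbT.
have dw : (decode p w) :&: U = set0.
  apply/eqP; rewrite setI_eq0; exact: disjointWl (decode_sub _ _) dpU.
have cU (B : {set T}) : B \subset U -> #|B :|: decode p w| = #|B| + weight w.
  move=> BU; rewrite cardsU card_decode //.
  rewrite (_ : B :&: _ = set0) ?cards0 ?subn0 //.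
  by apply/eqP; rewrite -subset0 -dw setIC setIS.
rewrite -(card_in_imset (f := fun A => A :&: U) (D := S)); last first.
  by move=> A B /SE AE /SE BE eqAB; rewrite AE BE eqAB.
apply: eq_card => B; rewrite !inE; apply/imsetP/andP => [[A SA ->]|[BU cB]].
  split; first exact: subsetIr.
  rewrite -cU ?subsetIr // -SE //.
  by move: SA; rewrite !inE => /andP[/andP[_]].
exists (B :|: decode p w); last by rewrite setIUl dw setU0 (setIidPl BU).
rewrite !inE cU // cB subUset (subset_trans BU (subsetUr _ _)).
rewrite (subset_trans (decode_sub _ _) (subsetUl _ _)) /=.
rewrite -{2}(decodeK Up szw); apply/eqP/eq_in_map => y py; rewrite !inE.
have -> // : y \in B = false.
by apply/negP=> /(subsetP BU); rewrite (disjointFr dpU) ?inE.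
Qed.

Lemma card_code_pred (T : finType) (p : seq T) (U : {set T}) (r : nat)
    (P : pred bitseq) :
  uniq p -> [disjoint [set y in p] & U] ->
  #|[set A in layer ([set y in p] :|: U) r | P (code p A)]|
    = \sum_(k <- [seq weight w | w <- words (size p) & P w])
        #|[set B : {set T} | (B \subset U) && (#|B| + k == r)]|.
Proof.
move=> Up dpU; rewrite big_map big_filter; set L := layer _ _.
transitivity (\sum_(w <- words (size p) | P w)
                \sum_(A in L) (code p A == w : nat)).
  rewrite exchange_big /= -sum1dep_card big_mkcondr /=; apply: eq_bigr => A _.
  rewrite big_mkcond (bigD1_seq (code p A)) ?uniq_words //=; last first.
    by rewrite mem_words size_code.
  rewrite eqxx big1 ?addn0 => [|w]; first by case: ifP.
  by rewrite eq_sym => /negbTE->; case: ifP.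
rewrite big_seq_cond [RHS]big_seq_cond; apply: eq_bigr => w /andP[+ _].
rewrite mem_words => /eqP szw.
by rewrite -(card_code_eq _ Up) // -sum1dep_card big_mkcondr; apply: eq_bigr.
Qed.

Lemma card_setU_disjoint (T : finType) (A B : {set T}) :
  (forall y, y \in A -> y \notin B) -> #|A :|: B| = #|A| + #|B|.
Proof.
move=> AB; rewrite cardsU [_ :&: _](_ : _ = set0) ?cards0 ?subn0 //.
by apply/setP=> y; rewrite !inE -in_setI; apply/negP=> /setIP[/AB/negP].
Qed.

(** Adding D is a bijection from G onto the sets counted here. *)
Lemma card_link (T : finType) (X V D : {set T}) (G : {set {set T}})
    (r k : nat) :
  V \subset X -> D \subset X :\: V -> G \subset layer V k -> #|D| + k = r ->
  #|[set A in layer X r | (A :\: V == D) && (A :&: V \in G)]| = #|G|.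
Proof.
move=> VX /[!subsetD] /andP[DX dDV] /subsetP GV Dk; set S := [set A in _ | _].
have SE A : A \in S -> A = (A :&: V) :|: D.
  by rewrite !inE => /and3P[_ /eqP <- _]; rewrite setID.
rewrite -(card_in_imset (f := fun A => A :&: V) (D := S)); last first.
  by move=> A B /SE AE /SE BE eqAB; rewrite AE BE eqAB.
apply: eq_card => B; apply/imsetP/idP => [[A + ->]|GB].
  by rewrite !inE => /and3P[].
have /[!inE] /andP[BV /eqP cB] := GV _ GB.
have DV : D :&: V = set0 by apply/eqP; rewrite setI_eq0.
have BVE : (B :|: D) :&: V = B by rewrite setIUl DV setU0 (setIidPl BV).
exists (B :|: D); last by rewrite BVE.
have BD : B :&: D = set0 by apply/eqP; rewrite -subset0 -DV setIC setIS.
rewrite !inE BVE GB subUset (subset_trans BV VX) DX cardsU BD cards0 subn0.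
rewrite cB addnC Dk eqxx setDUl (setDidPl dDV) andbT /=.
by move: BV; rewrite -setD_eq0 => /eqP->; rewrite set0U eqxx.
Qed.

Lemma card_free (T : finType) (U : {set T}) (a b alpha beta gamma x : T)
    (d : nat) :
  let p := [:: a; b; alpha; beta; gamma; x] in
  let X := [set y in p] :|: U in
  uniq p -> [disjoint [set y in p] & U] -> 2 <= d ->
  #|[set A in layer X d.+1 | free (code p A)]|
    = 'C(#|X| - 1, d) + 'C(#|X| - 4, d - 2).
Proof.
move=> p X Up dpU d2; have p6 : size p = 6 by [].
have Xp y : y \in p -> y \in X by move=> py; apply/setUP; left; rewrite inE.
rewrite (card_code_pred d.+1 free Up dpU) p6.
rewrite (perm_big _ free_weights) big_cat.
(* Regroup the sets by word, now for an arbitrary condition on words. *)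
have byword P := esym (card_code_pred d.+1 P Up dpU).
rewrite p6 in byword; congr (_ + _).
  rewrite [LHS](byword (fun w => nth false w i_a)).
  have <- : #|[set A in layer X d.+1 | ([set a] \subset A)
                          && [disjoint A & set0]]| = 'C(#|X| - 1, d).
    rewrite card_in_out ?sub0set ?cards1 ?cards0 ?subn0 ?subn1 //.
      by rewrite sub1set Xp ?inE ?eqxx.
    by rewrite -setI_eq0 setI0.
  apply: eq_card => A.
  by rewrite !inE sub1set -setI_eq0 setI0 eqxx andbT.
rewrite [LHS](byword (fun w => [&& nth false w i_a, nth false w i_b,
                                nth false w i_alpha & ~~ nth false w i_beta])).
have c3 : #|[set a; b; alpha]| = 3.
  rewrite -[RHS](card_uniqP (take_uniq 3 Up)).
  by apply: eq_card => y; rewrite !inE -orbA.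
have <- : #|[set A in layer X d.+1 | ([set a; b; alpha] \subset A)
                        && [disjoint A & [set beta]]]| = 'C(#|X| - 4, d - 2).
  rewrite card_in_out ?c3 ?cards1 -?subnDA //.
  + by rewrite !subUset !sub1set !Xp ?inE ?eqxx ?orbT.
  + by rewrite sub1set Xp ?inE ?eqxx ?orbT.
  + have: uniq (rcons [:: a; b; alpha] beta) := take_uniq 4 Up.
    by rewrite rcons_uniq disjoint_sym disjoints1 !inE -orbA => /andP[].
apply: eq_card => A; rewrite !inE !subUset !sub1set.
by rewrite disjoint_sym disjoints1 -!andbA.
Qed.

(** * The construction *)

Lemma meet_nseq w : meet w (nseq (size w) true) = w.
Proof. by elim: w => //= b w IH; rewrite /meet /= andbT -/(meet _ _) IH. Qed.

Theorem proposition3p1 (d n : nat) (hd : 4 <= d) (hn : d + 3 <= n)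
  (T : finType) (U C : {set T}) (a b alpha beta gamma x : T)
  (hU : #|U| = n - 6)
  (hdistinct : uniq [:: a; b; alpha; beta; gamma; x])
  (hC : C = [set a; b; alpha; beta; gamma; x])
  (hCU : [disjoint C & U])
  (H K1 K2 : {set {set T}})
  (hH : H \subset layer (x |: U) (d - 2))
  (hVCH : (VC H <= (d%:Z - 3)%:E)%E)
  (hK1 : K1 \subset layer U (d - 3))
  (hVCK1 : (VC K1 <= (d%:Z - 4)%:E)%E)
  (hK2 : K2 \subset layer U (d - 3))
  (hVCK2 : (VC K2 <= (d%:Z - 4)%:E)%E) :
  exists F : {set {set T}},
    [/\ F \subset layer (C :|: U) (d + 1),
        (VC F <= (d%:Z)%:E)%E
      & #|F| = 'C(n - 1, d) + 'C(n - 4, d - 2) + #|H| + #|K1| + #|K2| ].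
Proof.
rewrite addn1; have n6 : 6 <= n by lia.
have cH : 3 + (d - 2) = d.+1 by lia.
have cK : 4 + (d - 3) = d.+1 by lia.
pose p := [:: a; b; alpha; beta; gamma; x].
have Up : uniq p by [].
have CE : C = [set y in p].
  by rewrite hC; apply/setP=> y; rewrite !inE -!orbA.
have p6 : size p = 6 by [].
have dpU : [disjoint [set y in p] & U] by rewrite -CE.
have pU y : y \in p -> (y \in U) = false.
  by move=> py; rewrite (disjointFr dpU) // inE.
have cU : code p (~: U) = nseq 6 true.
  by rewrite /code /= !inE !pU ?inE ?eqxx ?orbT.
have cxU : code p (~: (x |: U)) = offx.
  have := rcons_uniq [:: a; b; alpha; beta; gamma] x; rewrite hdistinct.
  move=> /esym/andP[+ _]; rewrite !inE !negb_or ![x == _]eq_sym.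
  case/and5P=> /negbTE xa /negbTE xb /negbTE xal /negbTE xbe /negbTE xga.
  by rewrite /code /= !inE !pU ?inE ?eqxx ?orbT // xa xb xal xbe xga.
pose L := layer (C :|: U) d.+1.
pose slot V w (G : {set {set T}}) :=
  [set A in L | (A :\: V == decode p w) && (A :&: V \in G)].
pose F0 := [set A in L | free (code p A)].
pose FH := slot (x |: U) wH H.
pose FK1 := slot U wK1 K1.
pose FK2 := slot U wK2 K2.
(* Words separate the four parts of F from one another. *)
have F0code A : A \in F0 -> ~~ reserved (code p A).
  rewrite inE => /andP[_]; apply: free_not_reserved; exact: size_code.
have FHcode A : A \in FH -> meet (code p A) offx = wH.
  by rewrite inE => /and3P[_ /eqP AV _]; rewrite -cxU (meet_codeD AV).
have slotUcode w G A : size w = 6 -> A \in slot U w G -> code p A = w.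
  move=> w6; rewrite inE => /and3P[_ /eqP AU _].
  by rewrite -(meet_codeD AU) // cU -[6](size_code p A) meet_nseq.
pose F := F0 :|: FH :|: FK1 :|: FK2.
have FL A : A \in F -> A \in L.
  by rewrite !inE => /orP[/orP[/orP[]|]|] /andP[].
have Fused A : A \in F -> code p A \in used_words.
  rewrite mem_filter mem_words size_code andbT => /setUP[/setUP[/setUP[]|]|].
  - by rewrite inE => /andP[_ ->].
  - by move=> /FHcode AH; rewrite /reserved AH eqxx orbT.
  - by move=> /slotUcode-> //; rewrite /reserved eqxx !orbT.
  - by move=> /slotUcode-> //; rewrite /reserved eqxx !orbT.
(* A reserved word forces the rest of a member into H, K1 or K2. *)
have FtoH A : A \in F -> meet (code p A) offx == wH -> A :&: (x |: U) \in H.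
  move=> /setUP[/setUP[/setUP[/F0code|]|/slotUcode->]|/slotUcode->] //.
    by rewrite /reserved => /norP[/negbTE->].
  by rewrite inE => /and3P[].
have FtoK1 A : A \in F -> code p A == wK1 -> A :&: U \in K1.
  move=> /setUP[/setUP[/setUP[/F0code|/FHcode]|]|/slotUcode->] //.
  - by rewrite /reserved => /norP[_ /norP[/negbTE->]].
  - by move=> + /eqP wA; rewrite wA.
  - by rewrite inE => /and3P[].
have FtoK2 A : A \in F -> code p A == wK2 -> A :&: U \in K2.
  move=> /setUP[/setUP[/setUP[/F0code|/FHcode]|/slotUcode->]|] //.
  - by rewrite /reserved => /norP[_ /norP[_ /negbTE->]].
  - by move=> + /eqP wA; rewrite wA.
  - by rewrite inE => /and3P[].
have LC A : A \in L -> A :\: U \subset [set y in p].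
  by rewrite inE -CE subDset setUC => /andP[].
have LxC A : A \in L -> A :\: (x |: U) \subset [set y in p].
  by move/LC; apply: subset_trans; rewrite setDS // subsetUr.
have codeDU A : code p (A :\: U) = code p A.
  by rewrite setDE codeI cU -[6](size_code p A) meet_nseq.
have codeDxU A : code p (A :\: (x |: U)) = meet (code p A) offx.
  by rewrite setDE codeI cxU.
have LU A : A \in L -> weight (code p A) + #|A :&: U| = d.+1.
  move=> LA; rewrite -codeDU weight_code // (setIidPl (LC _ LA)) addnC cardsID.
  by move: LA; rewrite inE => /andP[_ /eqP].
have LxU A :
    A \in L -> weight (meet (code p A) offx) + #|A :&: (x |: U)| = d.+1.
  move=> LA; rewrite -codeDxU weight_code // (setIidPl (LxC _ LA)).
  rewrite addnC cardsID.
  by move: LA; rewrite inE => /andP[_ /eqP].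
have FsubL : F \subset L by apply/subsetP.
exists F; split=> //.
  apply: (VC_uniform FsubL) => A FA; have LA := FL A FA.
  case/or3P: (used_word_escapes (Fused A FA)).
  - (* The members selected by Q have too few points in U. *)
    move=> esc; pose G := [set B : {set T} | #|B| < #|A :&: U|].
    apply: (escape_not_shattered (G := G) Up p6 esc Fused (LC _ LA) (codeDU A)).
      move=> B FB ltAB; rewrite inE -(ltn_add2l (weight (code p A))) LU //.
      by rewrite -(LU B (FL B FB)) ltn_add2r.
    by apply: not_shattered_small => B; rewrite inE.
  - case/andP=> /eqP w4 /orP[] esc.
    + apply: (escape_not_shattered Up p6 esc Fused (LC _ LA) (codeDU A) FtoK1).
      by apply: (@card_gt_VC _ _ _ d 4 hVCK1); rewrite -w4 LU.
    + apply: (escape_not_shattered Up p6 esc Fused (LC _ LA) (codeDU A) FtoK2).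
      by apply: (@card_gt_VC _ _ _ d 4 hVCK2); rewrite -w4 LU.
  - case/andP=> /eqP w3 esc.
    apply: (escape_not_shattered Up p6 esc Fused (LxC _ LA) (codeDxU A) FtoH).
    by apply: (@card_gt_VC _ _ _ d 3 hVCH); rewrite -w3 LxU.
have cC : #|[set y in p]| = 6 by rewrite cardsE (card_uniqP Up).
have cX : #|C :|: U| = n.
  by rewrite CE cardsU (disjoint_setI0 dpU) cards0 cC hU subn0 subnKC.
have dec_sub w : decode p w \subset (C :|: U) :\: U.
  by rewrite setDUl setDv setU0 CE (setDidPl _) ?decode_sub.
have cFK w (G : {set {set T}}) : size w = 6 -> weight w = 4 ->
    G \subset layer U (d - 3) -> #|slot U w G| = #|G|.
  move=> w6 w4 GU; apply: (card_link _ _ GU); rewrite ?subsetUr ?dec_sub //.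
  by rewrite card_decode // w4.
have cFH : #|FH| = #|H|.
  apply: (card_link _ _ hH).
  - by rewrite setSU // CE sub1set !inE eqxx !orbT.
  - apply: subset_trans (setSD _ (subsetUl C U)).
    apply: (@decode_subset _ p) => //; first by rewrite CE subsetDl.
    by rewrite codeDxU CE /code /= !inE !eqxx !orbT.
  - by rewrite card_decode.
have cF0 : #|F0| = 'C(n - 1, d) + 'C(n - 4, d - 2).
  by rewrite /F0 /L -cX CE; apply: card_free; rewrite // ltnW // ltnW.
rewrite -cF0 -cFH -(cFK wK1 K1) // -(cFK wK2 K2) // /F !card_setU_disjoint //.
- move=> A /F0code; apply: contra => /FHcode wA.
  by rewrite /reserved wA eqxx.
- move=> A /setUP[/F0code|/FHcode] wA; apply/negP=> /slotUcode E; move: wA.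
    by rewrite /reserved E // eqxx orbT.
  by rewrite E.
- move=> A /setUP[/setUP[/F0code|/FHcode]|/slotUcode] wA;
    apply/negP=> /slotUcode E; move: wA.
  + by rewrite /reserved E // eqxx !orbT.
  + by rewrite E.
  + by rewrite E // => /(_ erefl).
Qed.
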